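(* The hyperspace $\mathcal{S}_c(\omega_1)$ of nontrivial convergent sequences of $\omega_1$ is a Baire space, where $\omega_1$ is the first uncountable ordinal equipped with the order topology.
   Context: For a Tychonoff space $X$, a nontrivial convergent sequence of $X$ is a subset $S\subseteq X$ such that $|S|=\omega$, $S$ (as a subspace) has a unique non-isolated point, denoted $x_S$, and $|S\setminus U|<\omega$ for each neighborhood $U$ of $x_S$. Let $\mathcal{CL}(X)$ be the set of all nonempty closed subsets of $X$, with the Vietoris topology: a base consists of the sets $\langle \mathcal{U}\rangle=\{F\in\mathcal{CL}(X): F\subseteq\bigcup\mathcal{U}\text{ and }F\cap U\neq\emptyset\text{ for all }U\in\mathcal{U}\}$, where $\mathcal{U}$ runs over nonempty finite families of nonempty open subsets of $X$. Let $\mathcal{S}_c(X)=\{S\in\mathcal{CL}(X): S\text{ is a nontrivial convergent sequence of }X\}$ with the subspace topology. A space is Baire if every countable intersection of dense open subsets is dense. *)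

(* Defs.v *)
From HB Require Import structures.
From mathcomp Require Import all_boot all_order.
From mathcomp Require Import all_classical wochoice.
From mathcomp Require Import topology.

Set Implicit Arguments.
Unset Strict Implicit.
Unset Printing Implicit Defensive.

Import Order.TTheory.

Local Open Scope classical_set_scope.

(* A linearly ordered type represents the ordinal omega_1 when it is
   well-ordered and uncountable while every proper initial segment, i.e. every
   smaller ordinal, is countable. This determines T up to order isomorphism;
   see [omega1_exists] for the existence of such a T. *)
Definition is_omega1 (d : Order.disp_t) (T : orderType d) : Prop :=
  [/\ well_order (fun x y : T => (x <= y)%O),
      ~ countable [set: T]
    & forall x : T, countable [set y : T | (y < x)%O]].

Lemma omega1_exists :
  exists (d : Order.disp_t) (T : orderType d), is_omega1 T.
Proof.
have [R wR] := well_ordering_principle (set nat).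
have wch : wo_chain R predT by move=> A _; exact: wR.
have Rtot : total R by move=> x y; exact: (wo_chainW wch).
have Rrefl : reflexive R by move=> x; have := Rtot x x; rewrite orbb.
have Ranti : antisymmetric R.
  by move=> x y xy; exact: (wo_chain_antisymmetric wch).
have Rtrans : transitive R.
  move=> y x z xy yz.
  have [|w [[wm wl] _]] := wR [pred t | [|| t == x, t == y | t == z]].
    by exists x; rewrite !inE eqxx.
  have wx : R w x by apply: wl; rewrite !inE eqxx.
  have wy : R w y by apply: wl; rewrite !inE eqxx orbT.
  have wz : R w z by apply: wl; rewrite !inE eqxx !orbT.
  move: wm; rewrite !inE => /or3P[] /eqP E; subst w => //.
    by have -> : x = y by apply: Ranti; rewrite xy wx.
  have yz' : y = z by apply: Ranti; rewrite yz wy.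
  by rewrite -yz'.
pose seg (x : set nat) := [set y | R y x /\ y <> x].
pose A := [set x | countable (seg x)].
pose T := set_type A.
pose le (x y : T) := R (val x) (val y).
have ler : reflexive le by move=> x; exact: Rrefl.
have lea : antisymmetric le by move=> x y xy; apply/val_inj/Ranti.
have let_ : transitive le by move=> y x z; exact: Rtrans.
have lett : total le by move=> x y; exact: Rtot.
pose P := HB.pack_for (porderType (Order.Disp tt tt)) T
  (Order.Le_isPOrder.Build (Order.Disp tt tt) T ler lea let_).
pose O := HB.pack_for (orderType (Order.Disp tt tt)) P
  (Order.POrder_isTotal.Build _ P lett).
exists (Order.Disp tt tt), O; split.
- move=> B [b Bb].
  have [|m [[mB ml] _]] := wR [pred x | `[< exists2 y : T, B y & sval y = x >]].
    by exists (sval b); rewrite unfold_in /=; apply/asboolP; exists b.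
  move: mB; rewrite unfold_in /= => /asboolP[m' Bm' m'E].
  have m'l (y : T) : B y -> le m' y.
    move=> By; suff : R m (sval y) by rewrite -m'E.
    by apply: ml; rewrite unfold_in /=; apply/asboolP; exists y.
  exists m'; split; first by split=> // y; exact: m'l.
  move=> z [Bz zl]; apply/lea/andP; split; first exact: m'l.
  exact: (zl _ Bm').
- move=> cT; have cA : countable A.
    by rewrite -(eq_countable (card_setT A)).
  have [AT|[x nAx]] : A = setT \/ exists x, ~ A x.
    have [|] := pselect (forall x, A x); last by right; exact/existsNP.
    by move=> H; left; apply/seteqP; split.
    move: cA; rewrite AT => /countable_injP[f finj].
    pose D := [set n | exists2 X : set nat, f X = n & ~ X n].
    have [DfD|nDfD] := pselect (D (f D)); last by apply: (nDfD); exists D.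
    have [X fX nX] := DfD.
    by have XD : X = D by [apply: finj; rewrite ?inE]; rewrite XD in nX.
  have [|m [[mm ml] _]] := wR [pred x | `[< ~ A x >]].
    by exists x; rewrite unfold_in /=; apply/asboolP.
  move: mm; rewrite unfold_in /= => /asboolP; apply.
  apply: sub_countable cA; apply: subset_card_le => y [ym yNm].
  apply: contrapT => nAy; apply: yNm; apply: Ranti; rewrite ym ml//.
  by rewrite unfold_in /=; apply/asboolP.
- move=> x; have : countable (seg (val x)) by have := set_valP x.
  move=> /countable_injP[f finj]; apply/countable_injP.
  have segP (y : O) : y \in [set y : O | (y < x)%O] -> sval y \in seg (sval x).
    rewrite !inE /= lt_neqAle => /andP[yx lyx]; split=> [|E]; first exact: lyx.
    by move/eqP: yx; apply; exact: val_inj.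
  exists (fun y : O => f (sval y)) => y z /segP ys /segP zs /(finj _ _ ys zs).
  exact: val_inj.
Qed.

Section hyperspace.
Variable X : topologicalType.

(* The nonempty closed subsets of X; the base of the Vietoris topology is
   { vietoris U | U in vietoris_index }. *)
Definition hyperspace : Type :=
  set_type [set F : set X | F !=set0 /\ closed F].

HB.instance Definition _ := Choice.on hyperspace.

Definition hset (F : hyperspace) : set X := val F.

Definition vietoris_index : set (set (set X)) :=
  [set U | [/\ finite_set U, U !=set0
            & forall V, U V -> open V /\ V !=set0]].

Definition vietoris (U : set (set X)) : set hyperspace :=
  [set F | hset F `<=` \bigcup_(V in U) V /\
           forall V, U V -> hset F `&` V !=set0].

Let vietoris_cover : \bigcup_(U in vietoris_index) vietoris U = setT.
Proof.
apply/seteqP; split=> // F _.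
have [[x Fx] _] := set_valP F; exists [set setT].
  split; [exact: finite_set1 | by exists setT |].
  by move=> _ ->; split; [exact: openT | exists x].
split; first by move=> y _; exists setT.
by move=> _ ->; exists x.
Qed.

Let vietoris_join U V F : vietoris_index U -> vietoris_index V ->
  vietoris U F -> vietoris V F ->
  exists W, [/\ vietoris_index W, vietoris W F &
             vietoris W `<=` vietoris U `&` vietoris V].
Proof.
pose cut (A B : set (set X)) := [set P `&` \bigcup_(Q in B) Q | P in A].
move=> [Ufin [U0 UU0] Uop] [Vfin [V0 VV0] Vop] [FU FmU] [FV FmV].
have cutop A B P : (forall V, A V -> open V /\ V !=set0) ->
    (forall V, B V -> open V /\ V !=set0) ->
    hset F `<=` \bigcup_(Q in B) Q ->
    (forall V, A V -> hset F `&` V !=set0) -> cut A B P ->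
    open P /\ hset F `&` P !=set0.
  move=> Aop Bop FB FA [Q AQ <-]; split.
    apply: openI; first exact: (Aop _ AQ).1.
    by apply: bigcup_open => W BW; exact: (Bop _ BW).1.
  by have [y [Fy Qy]] := FA _ AQ; exists y; split=> //; split=> //; exact: FB.
have UV P : cut U V P -> _ := cutop U V P Uop Vop FV FmU.
have VU P : cut V U P -> _ := cutop V U P Vop Uop FU FmV.
have WP P : (cut U V `|` cut V U) P -> open P /\ hset F `&` P !=set0.
  by case; [exact: UV | exact: VU].
exists (cut U V `|` cut V U); split.
- split.
  + by rewrite finite_setU; split; exact: finite_image.
  + by exists (U0 `&` \bigcup_(Q in V) Q); left; exists U0.
  + by move=> P /WP[oP [y [_ Py]]]; split=> //; exists y.
- split; last by move=> P /WP[].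
  move=> y Fy; have [P UP Py] := FU _ Fy.
  by exists (P `&` \bigcup_(Q in V) Q); [left; exists P | split=> //; exact: FV].
- move=> G [Gs Gm]; split; split.
  + move=> y /Gs[_ [[P UP <-]|[P VP <-]]]; first by case=> Py _; exists P.
    by case.
  + move=> P UP; have [|y [Gy [Py _]]] := Gm (P `&` \bigcup_(Q in V) Q).
      by left; exists P.
    by exists y.
  + move=> y /Gs[_ [[P UP <-]|[P VP <-]]]; first by case.
    by case=> Py _; exists P.
  + move=> P VP; have [|y [Gy [Py _]]] := Gm (P `&` \bigcup_(Q in U) Q).
      by right; exists P.
    by exists y.
Qed.

HB.instance Definition _ :=
  isBaseTopological.Build hyperspace vietoris_cover vietoris_join.

(* [isolated S] is the set of points of S isolated in the subspace S, so the
   set equation below says that x is the unique non-isolated point of S. *)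
Definition nontrivial_convergent_sequence (S : set X) : Prop :=
  (S #= [set: nat])%card /\
  exists x : X, S `\` isolated S = [set x] /\
    forall U : set X, nbhs x U -> finite_set (S `\` U).

(* As a type, [Sc] is the subtype [set_type Sc], whose topology is the subspace
   (initial) topology of the inclusion into [hyperspace]. *)
Definition Sc : set hyperspace :=
  [set S | nontrivial_convergent_sequence (hset S)].

End hyperspace.
Arguments Sc X : clear implicits.

Definition baire_space (X : topologicalType) : Prop :=
  forall F : nat -> set X,
    (forall n, open (F n) /\ dense (F n)) -> dense (\bigcap_n F n).

(* Main.v *)
Require Import Defs.
From HB Require Import structures.
From mathcomp Require Import all_boot all_order.
From mathcomp Require Import interval.
From mathcomp Require Import all_classical wochoice topology.

(** Let F_n be dense open subsets of S_c(omega_1) and O a nonempty open one.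
A point of O lying in every F_n is built as the limit of a descending sequence
of boxes.  A [stage] consists of a finite set P of isolated points of omega_1
and two points a < b with b not isolated; its box is the set of sequences S
with P included in S and S included in P `|` ]a, b].

Isolated points are dense in omega_1, because the least element of an open set
is isolated.  Hence every nonempty open part of a box contains a smaller box
([stage_refine]): if the part contains S, converging to x, take x as the new b,
and replace the finitely many points by which S meets the open sets of a
Vietoris neighborhood by isolated points.  Boxes are open and nonempty
([box_open], [stage_inhabited]), so one can go on inside F_0, F_1, ...

The point is that b never increases: the new b is a nonisolated point of
P `|` ]a, b], hence of ]a, b].  By well-ordering, b is constant from some stage
on.  All along, a is chosen above the n-th term of a sequence fixed in advance
that is cofinal in b ([ladder]), which exists because b has countably many
predecessors.  So the intervals ]a, b] finally shrink to b, and b together with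
all the sets P is a convergent sequence lying in every box ([stages_limit]). *)

Set Implicit Arguments.
Unset Strict Implicit.
Unset Printing Implicit Defensive.

Import Order.TTheory.
Local Open Scope order_scope.
Local Open Scope classical_set_scope.

(** * Convergent sequences of isolated points *)

Lemma countable_setU {T : Type} (A B : set T) :
  countable A -> countable B -> countable (A `|` B).
Proof.
move=> cA cB; rewrite -bigcup2E; apply: bigcup_countable => //.
by move=> [|[|n]] _ //=; exact: countable0.
Qed.

(** The set b |` A is closed because a point y different from b has a
neighborhood disjoint from a neighborhood V of b, and only the finite, hence
closed, set A `\` V remains to be avoided near y. *)
Lemma isolated_sequence_in_Sc {X : topologicalType} (A : set X) (b : X) :
  hausdorff_space X -> countable A -> infinite_set A ->
  (forall p, A p -> open [set p]) -> ~ A b ->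
  (forall U, nbhs b U -> finite_set (A `\` U)) ->
  exists S : Sc X, hset (val S) = b |` A.
Proof.
move=> hX cA iA oA nAb cvA.
have clA : closed (b |` A).
  rewrite -openC openE => y nSy.
  have yb : y != b by apply/eqP => yb; apply: nSy; left.
  move: (hX); rewrite open_hausdorff => /(_ y b yb).
  move=> [[U V] /= [Uy Vb] [oU oV UV]].
  have clAV : closed (A `\` V).
    apply: accessible_finite_set_closed.1 (hausdorff_accessible hX) _ _.
    by apply: cvA; apply: open_nbhs_nbhs; split => //; exact: set_mem.
  have : nbhs y (U `&` ~` (A `\` V)).
    apply: open_nbhs_nbhs; split.
      by apply: openI => //; exact: closed_openC.
    by split; [exact: set_mem | move=> [Ay _]; apply: nSy; right].
  apply: filterS => z [Uz nz].
  have nVz : ~ V z by move=> Vz; have : set0 z by rewrite -(eqP UV).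
  by move=> [zb|Az]; [apply: nVz; rewrite zb; exact: set_mem | apply: nz].
have cvS : nontrivial_convergent_sequence (b |` A).
  split; last exists b; last split.
  - apply: eq_card_nat => //; last by move/(sub_finite_set (@subsetUr _ _ _)).
    by apply: countable_setU => //; exact: countable1.
  - apply/seteqP; split=> [y [[//|Ay] niy]|_ ->].
      exfalso; apply: niy; split; first by rewrite inE; right.
      exists [set y]; first by apply: open_nbhs_nbhs; split => //; exact: oA.
      by apply/seteqP; split=> [z []//|z ->]; split=> //; right.
    split; first by left.
    (* If b were isolated in b |` A, some neighborhood V of b would miss A, and
       A = A `\` V would be finite. *)
    move=> [_ [V bV VS]]; apply: iA.
    suff -> : A = A `\` V by exact: cvA.
    apply/seteqP; split=> [z Az|z []//]; split=> // Vz.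
    apply: nAb; have <- // : z = b.
    by have : (V `&` (b |` A)) z by [split => //; right]; rewrite VS.
  - move=> U bU; apply: sub_finite_set (cvA _ bU) => z [[->|//] nU].
    by exfalso; apply: nU; exact: nbhs_singleton.
have neA : (b |` A) !=set0 by exists b; left.
pose H : hyperspace X := SigSub (mem_set (conj neA clA)).
have HSc : Sc X H by [].
by exists (SigSub (mem_set HSc)).
Qed.

(** * Boxes in the hyperspace *)

Definition box {X : topologicalType} (P K : set X) : set (Sc X) :=
  [set S | P `<=` hset (val S) /\ hset (val S) `<=` K].

Lemma open_vietoris {X : topologicalType} (U : set (set X)) :
  vietoris_index U -> open (vietoris U).
Proof.
move=> iU; exists [set U]; first by move=> _ ->.
by rewrite bigcup_set1.
Qed.

Lemma Sc_open_vietoris {X : topologicalType} (O : set (Sc X)) (S : Sc X) :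
  open O -> O S -> exists U, [/\ vietoris_index U, vietoris U (val S)
    & forall S' : Sc X, vietoris U (val S') -> O S'].
Proof.
case=> W [D sD <-] <- [U DU US]; exists U; split => //; first exact: sD.
by move=> S' US'; exists U.
Qed.

(** On S_c(X), the box is cut out by the Vietoris set of the family formed by K
and the singletons of P; this family is a legitimate index only when K is
nonempty, and it bounds S by K only when P is included in K.  Otherwise the box
is empty. *)
Lemma box_open {X : topologicalType} (P K : set X) :
  finite_set P -> (forall p, P p -> open [set p]) -> open K -> open (box P K).
Proof.
move=> fP oP oK; have [->|/set0P K0] := eqVneq K set0.
  suff -> : box P set0 = set0 by exact: open0.
  apply/seteqP; split=> // S [_ S0].
  have /= [[x Sx] _] := set_valP (val S); exact: S0 x Sx.
pose U : set (set X) := K |` [set [set p] | p in P].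
have [sPK|nPK] := pselect (P `<=` K); last first.
  suff -> : box P K = set0 by exact: open0.
  apply/seteqP; split=> // S [PS SK].
  by apply: nPK; exact: subset_trans PS SK.
have iU : vietoris_index U.
  split; last 1 first.
  - move=> V [->//|[p Pp <-]]; split; first exact: oP.
    by exists p.
  - by rewrite finite_setU; split; [exact: finite_set1 | exact: finite_image].
  - by exists K; left.
exists (vietoris U); first exact: open_vietoris.
apply/seteqP; split=> S /=.
  move=> [SU US]; split.
    move=> p Pp; have [|q [Sq]] := US [set p]; first by right; exists p.
    by move=> <-.
  by move=> y /SU[V [->//|[p Pp <-]]] ->; exact: sPK.
move=> [PS SK]; split; first by move=> y Sy; exists K; [left | exact: SK].
move=> V [->|[p Pp <-]]; last by exists p; split => //; exact: PS.
have /= [[x Sx] _] := set_valP (val S); exists x; split => //; exact: SK.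
Qed.

(** * Well-ordered spaces *)

Section well_ordered_space.
Context {d : Order.disp_t} {X : orderTopologicalType d}.
Hypothesis wo : well_order (fun x y : X => x <= y).

Lemma well_order_min (A : set X) :
  A !=set0 -> exists2 m, A m & forall y, A y -> m <= y.
Proof.
move=> [a Aa]; have [|m [[mA lm] _]] := @wo [pred x | `[< A x >]].
  by exists a; rewrite unfold_in /=; apply/asboolP.
exists m; first by move: mA; rewrite unfold_in /= => /asboolP.
by move=> y Ay; apply: lm; rewrite unfold_in /=; apply/asboolP.
Qed.

Lemma open_le (b : X) : open [set y | y <= b].
Proof.
have [[z bz]|nz] := pselect ([set z | b < z] !=set0); last first.
  suff -> : [set y | y <= b] = setT by exact: openT.
  apply/seteqP; split=> // y _ /=; rewrite leNgt; apply/negP => by_.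
  by apply: nz; exists y.
have [m bm mmin] := @well_order_min [set z | b < z] (ex_intro _ z bz).
suff -> : [set y | y <= b] = `]-oo, m[%classic by exact: lray_open.
apply/seteqP; split=> y /=; rewrite in_itv /=.
  by move=> yb; exact: le_lt_trans bm.
by move=> ym; rewrite leNgt; apply/negP => /mmin; rewrite leNgt ym.
Qed.

Lemma open_Ioc (a b : X) : open [set y | a < y <= b].
Proof.
suff -> : [set y | a < y <= b] = `]a, +oo[%classic `&` [set y | y <= b].
  by apply: openI; [exact: rray_open | exact: open_le].
apply/seteqP; split=> y /=; rewrite in_itv /= andbT; first by move/andP.
by move=> [-> ->].
Qed.

(** The witness is the least element m of U: the set of points at most m is open
and meets U in m only. *)
Lemma open_isolated (U : set X) :
  open U -> U !=set0 -> exists2 m, U m & open [set m].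
Proof.
move=> oU /well_order_min[m Um mmin]; exists m => //.
suff -> : [set m] = U `&` [set y | y <= m].
  by apply: openI => //; exact: open_le.
apply/seteqP; split=> [_ ->|y [Uy ym]]; first by split => /=.
by apply/eqP; rewrite eq_le ym mmin.
Qed.

Lemma nonisolated_gt (b : X) : ~ open [set b] -> [set y | y < b] !=set0.
Proof.
move=> nb; apply: contrapT => H; apply: nb.
suff -> : [set b] = [set y | y <= b] by exact: open_le.
apply/seteqP; split=> [_ ->//=|y]; rewrite /= le_eqVlt => /orP[/eqP//|yb].
by exfalso; apply: H; exists y.
Qed.

Lemma nonisolated_between (a b : X) :
  ~ open [set b] -> a < b -> exists2 q, open [set q] & a < q < b.
Proof.
move=> nb ab; have [||q] := @open_isolated `]a, b[%classic.
- exact: itv_open.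
- apply: contrapT => H; apply: nb.
  suff -> : [set b] = [set y | a < y <= b] by exact: open_Ioc.
  apply/seteqP; split=> [_ -> /=|y /= /andP[ay]]; first by rewrite ab lexx.
  rewrite le_eqVlt => /orP[/eqP//|yb].
  by exfalso; apply: H; exists y; rewrite /= in_itv /= ay.
- by rewrite /= in_itv /= => abq oq; exists q.
Qed.

Lemma nbhs_Ioc (b : X) (U : set X) : ~ open [set b] -> nbhs b U ->
  exists2 y, y < b & [set z | y < z <= b] `<=` U.
Proof.
move=> nb; rewrite itv_nbhsE => -[[l r] [io bi] iU].
have [y0 y0b] := nonisolated_gt nb.
have [y yb yi] : exists2 y, y < b & forall z, y < z -> (l <= BLeft z)%O.
  case: l io bi {iU} => [[] l|[]] io bi.
  - by case: r io {bi} => [[]|[]].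
  - by exists l => //; move: bi; rewrite itv_boundlr => /andP[].
  - by exists y0.
  - by move: bi; rewrite itv_boundlr.
exists y => // z /= /andP[yz zb]; apply: iU => /=; rewrite itv_boundlr yi //=.
by move: bi; rewrite itv_boundlr => /andP[_]; apply: le_trans; rewrite bnd_simp.
Qed.

(** The form of [isolated_sequence_in_Sc] in which convergence to b is tested on
the intervals ]y, b] only.  Points of A above b are allowed, but there are
finitely many of them, so A is countable like the initial segment of b. *)
Lemma isolated_sequence_to (b : X) (A : set X) :
  ~ open [set b] -> countable [set y | y < b] ->
  (forall p, A p -> open [set p]) ->
  (forall y, y < b -> finite_set (A `\` [set z | y < z <= b])) ->
  (forall y, y < b -> exists2 q, A q & y < q < b) ->
  exists S : Sc X, hset (val S) = b |` A.
Proof.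
move=> nb cb oA fA cofA; have [y0 y0b] := nonisolated_gt nb.
have nAb : ~ A b by move=> /oA.
apply: isolated_sequence_in_Sc => //; first exact: order_hausdorff.
- apply: (@sub_countable _ _ _ ([set y | y < b] `|`
    (A `\` [set z | y0 < z <= b]))).
    apply: subset_card_le => z Az.
    have [zb|bz] := ltP z b; [by left | right; split => //= /andP[_ zb]].
    by apply: nAb; have <- : z = b by apply/eqP; rewrite eq_le zb bz.
  apply: countable_setU => //; exact/finite_set_countable/fA.
- move=> finA; have : nbhs b (~` A).
    apply: open_nbhs_nbhs; split => //; apply: closed_openC.
    apply: accessible_finite_set_closed.1 finA.
    exact/hausdorff_accessible/order_hausdorff.
  move=> /(nbhs_Ioc nb)[y yb yA]; have [q Aq /andP[yq qb]] := cofA _ yb.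
  by apply: (yA q) => //=; rewrite yq ltW.
- move=> U /(nbhs_Ioc nb)[y yb yU]; apply: sub_finite_set (fA y yb).
  by move=> z [Az nUz]; split => // /yU.
Qed.

(** * Stages and their refinement *)

Definition ladder (c : nat -> X) (b : X) :=
  (forall n, c n < b) /\
  forall y, y < b -> exists N, forall n, (N <= n)%N -> y <= c n.

(** The running maxima of an enumeration of the predecessors of b. *)
Lemma ladder_exists (b : X) : ~ open [set b] -> countable [set y | y < b] ->
  exists c, ladder c b.
Proof.
move=> /nonisolated_gt b0 /pfcard_geP[E|]; first by move: b0; rewrite E => -[].
move=> /surjfunPex[e eE].
have eb n : e n < b by have : [set y | y < b] (e n) by rewrite eE; exists n.
pose c := fix c n := if n is m.+1 then Order.max (c m) (e m.+1) else e 0%N.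
exists c; split.
  by elim=> [|n IH] /=; [exact: eb | rewrite gt_max IH eb].
move=> y yb; have [m _ <-] : [set e m | m in setT] y by rewrite -eE.
exists m; elim=> [|n IH]; first by rewrite leqn0 => /eqP ->.
rewrite leq_eqVlt => /orP[/eqP ->|/IH cn] /=.
  by rewrite le_max lexx orbT.
by rewrite le_max cn.
Qed.

Record stage := Stage {pts : set X; lo : X; hi : X}.

Definition room (s : stage) := pts s `|` [set y | lo s < y <= hi s].

(** The point of [pts s] between [lo s] and [hi s] ensures that the union of the
sets [pts s] along a descending sequence of stages accumulates at the limit. *)
Definition wf_stage (s : stage) :=
  [/\ finite_set (pts s), forall p, pts s p -> open [set p],
      ~ open [set hi s] & exists2 q, pts s q & lo s < q < hi s].

Lemma room_open (s : stage) : wf_stage s -> open (room s).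
Proof.
move=> [_ oP _ _]; apply: openU; last exact: open_Ioc.
suff -> : pts s = \bigcup_(p in pts s) [set p] by exact: bigcup_open.
by rewrite bigcup_imset1 image_id.
Qed.

(** A ladder of [hi s] need not consist of isolated points, but there is an
isolated point between each of its terms and [hi s]; these points, together with
[pts s] and [hi s], form an element of the box. *)
Lemma stage_inhabited (s : stage) : wf_stage s ->
  countable [set y | y < hi s] -> box (pts s) (room s) !=set0.
Proof.
move=> [fP oP nb [q0 Pq0 /andP[q0l q0h]]] cb; set b := hi s in nb q0h cb *.
have [c [cb_ cc]] := ladder_exists nb cb.
have /choice[q qP] n : exists q, open [set q] /\ Order.max (lo s) (c n) < q < b.
  have [|q oq qn] := @nonisolated_between (Order.max (lo s) (c n)) b nb.
    by rewrite gt_max (lt_trans q0l q0h) cb_.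
  by exists q.
have [|||S SE] := @isolated_sequence_to b (pts s `|` range q) nb cb.
- by move=> p [/oP//|[n _ <-]]; case: (qP n).
- move=> y yb; have [N yN] := cc y yb.
  apply: (@sub_finite_set _ _ (pts s `|` [set q n | n in `I_N])).
    move=> z [[Pz|[n _ <-]] nz]; [by left | right; exists n => //=].
    rewrite ltnNge; apply/negP => Nn; apply: nz => /=.
    have [_ /andP[]] := qP n; rewrite gt_max => /andP[_ cq] /ltW ->.
    by rewrite (le_lt_trans (yN _ Nn) cq).
  by rewrite finite_setU; split => //; exact/finite_image/finite_II.
- move=> y yb; have [N yN] := cc y yb; exists (q N); first by right; exists N.
  have [_ /andP[]] := qP N; rewrite gt_max => /andP[_ cq] ->.
  by rewrite (le_lt_trans (yN _ (leqnn N)) cq).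
exists S; split; rewrite SE; first by move=> p Pp; right; left.
move=> y [->|[Py|[n _ <-]]]; last 1 first.
- right; have [_ /andP[]] := qP n; rewrite gt_max /= => /andP[-> _].
  by move=> /ltW.
- by right => /=; rewrite (lt_trans q0l q0h) lexx.
- by left.
Qed.

(** Take S in the open set, with nonisolated point x, and a Vietoris
neighborhood of S inside O, given by a finite family U.  Each V in U meets S,
hence V `&` K contains an isolated point z V; adding these to P makes every
element of the new box meet every V.  Conversely the new points, and an
interval ]a, x] inside K and inside a member of U containing x, stay in the
union of U.  The function e prescribes a lower bound for a depending on x, which
is known only once S has been chosen. *)
Lemma stage_refine (P K : set X) (O : set (Sc X)) (e : X -> X) :
  finite_set P -> (forall p, P p -> open [set p]) -> open K ->
  (forall b, ~ open [set b] -> e b < b) ->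
  open O -> box P K `&` O !=set0 ->
  exists s, [/\ wf_stage s, P `<=` pts s, room s `<=` K,
    box (pts s) (room s) `<=` O & e (hi s) <= lo s].
Proof.
move=> fP oP oK eb oO [S [[PS SK] OS]].
have [U [[fU U0 oU] [SU US] UO]] := Sc_open_vietoris oO OS.
have [_ [x [Sx _]]] : nontrivial_convergent_sequence (hset (val S)).
  exact: set_valP S.
have [Sxx nix] : (hset (val S) `\` isolated (hset (val S))) x by rewrite Sx.
have nx : ~ open [set x].
  move=> ox; apply: nix; split; first by rewrite inE.
  exists [set x]; first by apply: open_nbhs_nbhs.
  by apply/seteqP; split=> [z []//|z ->].
have [Vx UVx Vxx] := SU _ Sxx.
have [y yx yVx] : exists2 y, y < x & [set z | y < z <= x] `<=` K `&` Vx.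
  apply: nbhs_Ioc => //; apply: open_nbhs_nbhs; split.
    by apply: openI => //; exact: (oU _ UVx).1.
  by split; [exact: SK|].
(* Outside U, the point x serves as a default value of z. *)
have /choice[z zP] V : exists z, U V -> [/\ V z, K z & open [set z]].
  have [UV|nUV] := pselect (U V); last by exists x.
  have [||z [Vz Kz] oz] := @open_isolated (V `&` K).
  - by apply: openI => //; exact: (oU _ UV).1.
  - by have [w [Sw Vw]] := US _ UV; exists w; split => //; exact: SK.
  - by exists z.
pose a := Order.max y (e x).
have ax : a < x by rewrite gt_max yx eb.
have [q oq qax] := nonisolated_between nx ax.
have aK w : a < w <= x -> (K `&` Vx) w.
  move=> /andP[aw wx]; apply: yVx => /=; rewrite wx andbT.
  by apply: le_lt_trans aw; rewrite le_max lexx.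
have [Kq Vxq] : (K `&` Vx) q.
  by apply: aK; case/andP: qax => -> /ltW ->.
pose s := Stage (P `|` (q |` [set z V | V in U])) a x.
exists s; split.
- split => //=; last by exists q => //; right; left.
    rewrite !finite_setU; split => //.
    by split; [exact: finite_set1 | exact: finite_image].
  by move=> p [/oP//|[->//|[V UV <-]]]; case: (zP V UV).
- by move=> p Pp; left.
- move=> w [[/PS/SK//|[->//|[V UV <-]]]|/aK[]//]; by case: (zP V UV).
- move=> S' [PS' SK']; apply: UO; split.
    move=> w /SK'[[/PS/SU//|[->|[V UV <-]]]|/aK[_ ?]]; [| |by exists Vx].
      by exists Vx.
    by exists V => //; case: (zP V UV).
  move=> V UV; exists (z V); split; last by case: (zP V UV).
  by apply: PS'; right; right; exists V.
- by rewrite /= le_max lexx orbT.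
Qed.

(** * Limit of a descending sequence of stages *)

Lemma stages_limit (s : nat -> stage) (c : X -> nat -> X) :
  (forall b : X, countable [set y | y < b]) ->
  (forall b, ~ open [set b] -> ladder (c b) b) ->
  (forall n, wf_stage (s n)) ->
  (forall n, pts (s n) `<=` pts (s n.+1)) ->
  (forall n, room (s n.+1) `<=` room (s n)) ->
  (forall n, c (hi (s n)) n <= lo (s n)) ->
  exists S : Sc X, forall n, box (pts (s n)) (room (s n)) S.
Proof.
move=> cX cP wf ptsS roomS loc.
have ptsW m n : (m <= n)%N -> pts (s m) `<=` pts (s n).
  elim: n => [|n IH]; first by rewrite leqn0 => /eqP ->.
  rewrite leq_eqVlt => /orP[/eqP ->//|/IH mn]; exact: subset_trans (ptsS n).
have roomW m n : (m <= n)%N -> room (s n) `<=` room (s m).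
  elim: n => [|n IH]; first by rewrite leqn0 => /eqP ->.
  rewrite leq_eqVlt => /orP[/eqP ->//|/IH mn].
  exact: subset_trans (roomS n) mn.
have hi_room n : room (s n) (hi (s n)).
  right => /=; rewrite lexx andbT.
  by have [_ _ _ [q _ /andP[]]] := wf n; exact: lt_trans.
(* [hi (s n)] lies in [room (s m)] and is not isolated, hence is not in
   [pts (s m)]. *)
have hiW m n : (m <= n)%N -> hi (s n) <= hi (s m).
  move=> mn; have [|/andP[]//] := roomW _ _ mn _ (hi_room n).
  by have [_ oP _ _] := wf m; have [_ _ nb _] := wf n; move=> /oP.
have [b [N _ Nb] bmin] := @well_order_min (range (hi \o s))
  (ex_intro _ _ (imageT (hi \o s) 0%N)).
have hib n : (N <= n)%N -> hi (s n) = b.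
  move=> Nn; apply/eqP; rewrite eq_le bmin; last by exists n.
  by rewrite andbT -Nb; exact: hiW.
have nb : ~ open [set b] by have [_ _] := wf N; rewrite hib.
have [cb cc] := cP b nb.
(* The bound on [lo] refers to the ladder of the current [hi], which is that
   of b only from N on. *)
have lo_cof y : y < b -> exists2 n, (N <= n)%N & y <= lo (s n).
  move=> yb; have [M yM] := cc y yb; exists (maxn N M); first exact: leq_maxl.
  apply: le_trans (loc _); rewrite hib ?leq_maxl //.
  by apply: yM; exact: leq_maxr.
pose A := \bigcup_n pts (s n).
have A_room n : A `<=` room (s n).
  move=> p [m _ pm]; have [mn|nm] := leqP m n.
    by left; exact: ptsW pm.
  by apply: (roomW _ _ (ltnW nm)); left.
have [|||S SE] := @isolated_sequence_to b A nb (cX b).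
- by move=> p [n _]; have [_ oP _ _] := wf n; exact: oP.
- move=> y /lo_cof[n Nn yn]; have [fP _ _ _] := wf n.
  apply: sub_finite_set fP => z [/(A_room n)[//|/=]].
  by rewrite hib // => /andP[/(le_lt_trans yn) -> ->].
- move=> y /lo_cof[n Nn yn]; have [_ _ _ [q Pq]] := wf n.
  rewrite hib // => /andP[lq qb]; exists q; first by exists n.
  by rewrite qb (le_lt_trans yn lq).
exists S => n; split; rewrite SE; first by move=> p Pp; right; exists n.
move=> y [->|/A_room//].
rewrite -(hib (maxn N n) (leq_maxl _ _)).
exact: (roomW _ _ (leq_maxr N n)).
Qed.

Lemma Sc_baire :
  (forall b : X, countable [set y | y < b]) -> baire_space (Sc X).
Proof.
move=> cX F FP O O0 oO.
have /choice[c cP] (b : X) : exists c, ~ open [set b] -> ladder c b.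
  have [ob|nb] := pselect (open [set b]); first by exists (fun=> b).
  by have [c cb] := ladder_exists nb (cX b); exists c.
have cb n b : ~ open [set b] -> c b n < b by move=> /cP[].
(* The first stage only has to fit into O: it refines no earlier one. *)
have [s0 [wf0 _ _ s0O c0]] : exists s, [/\ wf_stage s, set0 `<=` pts s,
    room s `<=` setT, box (pts s) (room s) `<=` O & c (hi s) 0%N <= lo s].
  apply: (@stage_refine _ _ _ (c^~ 0%N)) => //; first exact: openT.
    exact: cb.
  by have [S OS] := O0; exists S; do 2!split => //.
have /choice[next nextP] (ns : nat * stage) : exists s, wf_stage ns.2 ->
    [/\ wf_stage s, pts ns.2 `<=` pts s, room s `<=` room ns.2,
     box (pts s) (room s) `<=` F ns.1 & c (hi s) ns.1.+1 <= lo s].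
  case: ns => n s /=; have [wfs|nwf] := pselect (wf_stage s); last by exists s.
  have [fP oP _ _] := wfs; have oR := room_open wfs.
  have [|s' s'P] :=
    @stage_refine _ _ (F n) (c^~ n.+1) fP oP oR (cb n.+1) (FP n).1.
    apply: (FP n).2 (box _ _) _ _; first exact: stage_inhabited.
    exact: box_open.
  by exists s'.
pose s := fix s n := if n is m.+1 then next (m, s m) else s0.
have wf n : wf_stage (s n).
  by elim: n => [//|n IH] /=; case: (nextP (n, s n) IH).
have sP n := nextP (n, s n) (wf n).
have [| | |S SP] := @stages_limit s c cX cP wf.
- by move=> n; case: (sP n).
- by move=> n; case: (sP n).
- by move=> [//|n]; case: (sP n).
exists S; split; first exact/s0O/(SP 0%N).
by move=> n _; case: (sP n) => _ _ _ + _; apply; exact: SP n.+1.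
Qed.

End well_ordered_space.

Theorem mainTheorem3 (d : Order.disp_t) (T : orderType d) :
  is_omega1 T -> baire_space (Sc (order_topology T)).
Proof. by move=> [wo _ cT]; exact: Sc_baire. Qed.
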